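(* Consider the $GI/M/c$ queueing model with one-step transition probabilities $p(i,j)$, $i,j\ge 0$, of the Markov chain imbedded at pre-arrival instants. Then: (i) For $j\le i+1\le c$, \[ p(i,j)=\binom{i+1}{i-j+1}\sum_{r=0}^{i-j+1}(-1)^r\binom{i-j+1}{r}A^*((j+r)\mu). \] (ii) For $c\le j\le i+1$, \[ p(i,j)=\frac{(c\mu)^{i-j+1}A^*_{i-j+1}(c\mu)}{(i-j+1)!}. \] (iii) For $j>0$ and $j+1\le c\le i$, \[ p(i,j)=\sum_{k=1}^{c-j}\frac{(-1)^{c-j-k}(c-k)\,C^a_{k,c-j}}{j}\left(\frac{c}{k}\right)^{i-c+2}\left[A^*((c-k)\mu)-\sum_{r=0}^{i-c+1}\frac{(k\mu)^rA^*_r(c\mu)}{r!}\right], \] where \[ C^a_{k,c-j}=\prod_{m=1}^{k-1}\frac{c-m}{k-m}\times\prod_{m=k+1}^{c-j}\frac{c-m}{m-k}, \] and products over empty index sets equal $1$. Moreover, $p(i,j)=0$ whenever $j>i+1$.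
   Context: The $GI/M/c$ model: customers arrive one at a time to an infinite-capacity system with $c\ge 1$ parallel identical servers. Inter-arrival times are i.i.d. with distribution function $A(t)$ on $[0,\infty)$ and mean $1/\lambda$; service times are i.i.d. exponential with mean $1/\mu$, $\mu>0$, independent of the arrivals. When $n$ customers are present the total service rate is $\min(n,c)\mu$. Let $X_n$ ($n=0,1,\dots$) be the number of customers in the system just before the $n$-th arrival; $\{X_n\}$ is a Markov chain and $p(i,j)=P\{X_n=j\mid X_{n-1}=i\}$ for $i,j\ge 0$. So $X_{n+1}=X_n+1-D_n$, where $D_n$ is the number of services completed during the $n$-th inter-arrival time. These probabilities have the well-known integral representations: for $0\le j\le i+1\le c$, $p(i,j)=\int_0^\infty\binom{i+1}{i-j+1}e^{-\mu tj}(1-e^{-\mu t})^{i-j+1}dA(t)$; for $c\le j\le i+1$, $p(i,j)=\int_0^\infty \frac{e^{-c\mu t}(c\mu t)^{i-j+1}}{(i-j+1)!}dA(t)$; for $j+1\le c\le i$, $p(i,j)=\binom{c}{c-j}\frac{(c\mu)^{i-c+1}}{(i-c)!}\int_0^\infty\int_0^t v^{i-c}e^{-\mu(t-v)j-c\mu v}(1-e^{-\mu(t-v)})^{c-j}\,dv\,dA(t)$; and $p(i,j)=0$ otherwise. The Laplace--Stieltjes transform of $A$ is $A^*(s)=\int_0^\infty e^{-st}dA(t)$, and $A^*_n(s)=(-1)^n\frac{d^nA^*(s)}{ds^n}=\int_0^\infty t^ne^{-st}dA(t)$ for $n\ge 0$, with $A^*_0=A^*$. *)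

(* Defs.v *)
From mathcomp Require Import all_boot all_order all_algebra.
From mathcomp Require Import all_classical all_reals all_analysis.

Set Implicit Arguments.
Unset Strict Implicit.
Unset Printing Implicit Defensive.

Import Order.TTheory GRing.Theory Num.Theory.
Import numFieldNormedType.Exports.

Local Open Scope classical_set_scope.
Local Open Scope ring_scope.

(* Mutual independence: the product rule over every finite subfamily, a
   subfamily being given by an injective enumeration f of its indices. *)
Definition mutually_independent d (Omega : measurableType d) (R : realType)
    (P : probability Omega R) (I : Type) (Z : I -> Omega -> R) : Prop :=
  forall (k : nat) (f : 'I_k -> I) (B : 'I_k -> set R),
    injective f -> (forall l, measurable (B l)) ->
    P (\bigcap_(l in [set: 'I_k]) (Z (f l) @^-1` B l)) =
    (\prod_(l < k) P (Z (f l) @^-1` B l))%E.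

(* P(E | F), meaningful when P F != 0. *)
Definition cond_prob d (Omega : measurableType d) (R : realType)
    (P : probability Omega R) (E F : set Omega) : R :=
  fine (P (E `&` F)) / fine (P F).

Inductive source :=
  | Initial
  | Interarrival of nat
  | Service of nat & nat & nat.

(* The primitive random variables of a GI/M/c queue, [A] being the common law
   of the inter-arrival times:
   - [initial]: the number of customers found by arrival 0;
   - [interarrival n]: the time between arrivals n and n+1;
   - [service n m s]: counted from the instant at which, between arrivals n and
     n+1, the number of customers present becomes m (just after arrival n, or at
     a service completion), the time that busy server s still needs to finish
     its current service.
   Services being exponential with rate mu, at each such instant the remaining
   service times at the busy servers are, by the memoryless property, again
   i.i.d. exponential with rate mu and independent of the past; hence one fresh
   independent family for each (n, m). This does not depend on the
   (work-conserving) order in which waiting customers are served. *)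
Record GIMc_queue d (Omega : measurableType d) (R : realType)
    (P : probability Omega R) (A : probability (measurableTypeR R) R) (mu : R) :=
  GIMcQueue {
    initial : {RV P >-> nat};
    interarrival : nat -> {RV P >-> R};
    service : nat -> nat -> nat -> {RV P >-> R};
    interarrival_law : forall n (B : set R), measurable B ->
      P (interarrival n @^-1` B) = A B;
    service_law : forall n m s (B : set R), measurable B ->
      P (service n m s @^-1` B) = exponential_prob mu B;
    primitives_independent : mutually_independent P
      (fun z : source => match z with
        | Initial => fun w => (initial w)%:R
        | Interarrival n => fun w => interarrival n w
        | Service n m s => fun w => service n m s w
        end)
  }.

Section Dynamics.
Context d (Omega : measurableType d) (R : realType) (P : probability Omega R).
Context (A : probability (measurableTypeR R) R) (mu : R).
Variables (Q : GIMc_queue P A mu) (c : nat).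

(* With m > 0 customers present, minn m c servers are busy (numbered from 0),
   and the next completion occurs at the first of them to finish. The index of
   the minimum is nonempty, so its default value [service Q n m 0] is one of
   the terms. *)
Definition sojourn (n m : nat) (w : Omega) : R :=
  \big[Order.min/service Q n m 0 w]_(s < minn m c) service Q n m s w.

(* Time from arrival n to the k-th subsequent service completion, m customers
   being present just after that arrival (k <= m). *)
Definition completion_time (n m k : nat) (w : Omega) : R :=
  \sum_(l < k) sojourn n (m - l) w.

Definition completed (n m : nat) (w : Omega) : nat :=
  #|[set k : 'I_m | completion_time n m k.+1 w <= interarrival Q n w]%SET|.

(* The number of customers in the system just before arrival n. *)
Fixpoint found (n : nat) (w : Omega) : nat :=
  if n is n'.+1 then
    (let m := (found n' w).+1 in m - completed n' m w)%N
  else initial Q w.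

(* P{X_(n+1) = j | X_n = i} *)
Definition transition (n i j : nat) : R :=
  cond_prob P [set w | found n.+1 w = j] [set w | found n w = i].

End Dynamics.

Definition LST (R : realType) (A : probability (measurableTypeR R) R) (s : R) : R :=
  (\int[A]_(t in `[0%R, +oo[) expR (- (s * t)))%R.

Definition LSTn (R : realType) (A : probability (measurableTypeR R) R)
    (n : nat) (s : R) : R :=
  (-1) ^+ n * derive1n n (LST A) s.

(* C^a_{k,e}, used for 1 <= k <= e <= c, where no natural-number subtraction
   below is truncated. *)
Definition Ca (R : realType) (c k e : nat) : R :=
  (\prod_(1 <= m < k) ((c - m)%N%:R / (k - m)%N%:R)) *
  (\prod_(k.+1 <= m < e.+1) ((c - m)%N%:R / (m - k)%N%:R)).

(* Main.v *)
From HB Require Import structures.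
Require Import Defs.
From mathcomp Require Import all_boot all_order all_algebra.
From mathcomp Require Import all_classical all_reals all_analysis.
From mathcomp Require Import measurable_realfun.
From mathcomp Require Import ring lra zify.

(** Between two arrivals nobody enters, so the number of customers is a pure
    death process: in state l it waits an exponential time of rate
    min (l, c) mu, independently of the past (sojourn_law), and then drops to
    l - 1. Let q_j(t) be the probability that this process, started in
    m = i + 1, is in state j at time t. Then p(i, j) is the mean of q_j(T) for
    an independent time T of law A.

    Instead of computing the multiple integrals of the classical derivation,
    the proof characterises q by the forward equations
    q_l' = rate (l + 1) q_(l+1) - rate l q_l, q_l(0) = [l = m].
    Summing them over the states from m - k to m gives, for the probability S_k(t)
    of at least k deaths by time t, the equation
    S_(k+1)' = rate (m - k) (S_k - S_(k+1)), S_(k+1)(0) = 0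
    (is_derive_survival). This is also the equation that describes what adding
    an independent exponential delay of rate (m - k) does to a distribution
    function (cdf_add_exponential). By induction on k, S_k is the distribution
    function of the k-th completion time (completion_time_cdf); hence at least
    k services end before the next arrival with probability the integral of S_k
    against A, and q_j = S_(m-j) - S_(m-j+1) gives
    p(i, j) = integral of q_j dA (transition_integral). Independence of the past
    from the present inter-arrival interval removes the conditioning; it comes
    from the product rule for the primitive variables by a Dynkin argument
    (info_independent).

    What remains is analysis. Three closed forms solve the forward equations:
    a binomial law when i < c (forward_thinning), a Poisson law when j >= c
    (forward_poisson), and in the mixed case a combination of exponentials
    expR (- (c - k) mu t), each minus a Taylor section of expR (k mu t) damped
    by expR (- c mu t) (forward_mixed). Integrated against A they are linear
    combinations of values of A* and of its derivatives, which are moments of A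
    with an exponential weight (LSTnE). The product defining C^a enters only
    through its expression by binomial coefficients (Ca_binomial). *)

Set Implicit Arguments.
Unset Strict Implicit.
Unset Printing Implicit Defensive.

Import Order.TTheory GRing.Theory Num.Theory.
Import numFieldNormedType.Exports.

Local Open Scope classical_set_scope.
Local Open Scope ring_scope.

(** * Closed forms for the pure death process *)

Section ForwardEquations.
Variables (R : realType).
Implicit Types (a b t mu : R) (c k l m j M : nat).

Lemma is_derive_linear a t : is_derive t 1 (fun u : R => a * u) a.
Proof. by apply: is_derive_eq; rewrite /GRing.scale/= mulr1. Qed.

Lemma is_derive_expR_linear a t :
  is_derive t 1 (fun u : R => expR (a * u)) (a * expR (a * t)).
Proof.
rewrite mulrC.
exact: (is_derive1_comp (is_derive_expR (a * t)) (is_derive_linear a t)).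
Qed.

Lemma is_derive_monomial a t k :
  is_derive t 1 (fun u : R => (a * u) ^+ k.+1 / (k.+1)`!%:R)
    (a * ((a * t) ^+ k / k`!%:R)).
Proof.
have h := is_deriveZ (k.+1)`!%:R^-1 (is_deriveX k.+1 (is_derive_linear a t)).
rewrite (_ : (fun _ => _) =
    (k.+1)`!%:R^-1 \*: ((fun u : R => a * u) ^+ k.+1)); last first.
  by apply/funext => u; rewrite mulrC !fctE.
apply: (is_derive_eq h).
rewrite /GRing.scale/= factS natrM.
field.
by rewrite -[1]/(1%:R) -natrD !pnatr_eq0 -lt0n fact_gt0.
Qed.

Lemma is_derive_sum_seq (I : eqType) (s : seq I) (f : I -> R -> R)
    (df : I -> R) t :
  (forall i, i \in s -> is_derive t 1 (f i) (df i)) ->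
  is_derive t 1 (fun u => \sum_(i <- s) f i u) (\sum_(i <- s) df i).
Proof.
elim: s => [|i s IH] h.
  rewrite big_nil; under eq_fun do rewrite big_nil.
  exact: is_derive_cst.
rewrite big_cons; under eq_fun do rewrite big_cons.
apply: is_deriveD; first by apply: h; rewrite mem_head.
by apply: IH => x xs; apply: h; rewrite in_cons xs orbT.
Qed.

(** Probability of k events by time t in a Poisson stream of intensity a: the
    law of the number of completions while all servers stay busy. *)
Definition poisson_weight a k t : R :=
  expR (- a * t) * ((a * t) ^+ k / k`!%:R).

Lemma poisson_weight0 a k : poisson_weight a k 0 = (k == 0)%:R.
Proof.
rewrite /poisson_weight !mulr0 expR0 mul1r expr0n.
by case: k => [|k]; rewrite /= ?mul0r// fact0 divr1.
Qed.

Lemma is_derive_poisson_weight a k t :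
  is_derive t 1 (poisson_weight a k)
    ((if (0 < k)%N then a * poisson_weight a k.-1 t else 0)
     - a * poisson_weight a k t).
Proof.
have h1 := is_derive_expR_linear (- a) t.
case: k => [|k]; rewrite /poisson_weight/=.
  under eq_fun do rewrite expr0 fact0 divr1 mulr1.
  by rewrite expr0 fact0 divr1 mulr1 sub0r -mulNr.
have h2 := is_derive_monomial a t k.
apply: (@is_derive_eq _ _ _ _ t 1 _ _ (is_deriveM h1 h2)).
by rewrite /GRing.scale/=; ring.
Qed.

(** For b = a, expR (- a * t) times this is the Erlang distribution function with
    M.+1 stages of rate a; smaller b occur when those stages are followed by
    slower ones. *)
Definition exp_tail b M t : R :=
  expR (b * t) - \sum_(0 <= r < M.+1) (b * t) ^+ r / r`!%:R.

Lemma exp_tail0 b M : exp_tail b M 0 = 0.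
Proof.
rewrite /exp_tail mulr0 expR0 big_nat_recl// expr0 fact0 divr1 big1 ?addr0 ?subrr//.
by move=> i _; rewrite expr0n mul0r.
Qed.

(** Differentiation shifts the exponential series by one index, so the derivative
    of the tail is b times the tail that starts one term earlier. *)
Lemma is_derive_exp_tail b M t :
  is_derive t 1 (exp_tail b M) (b * (exp_tail b M t + (b * t) ^+ M / M`!%:R)).
Proof.
have h1 := is_derive_expR_linear b t.
have h2 : is_derive t 1
    (fun t => \sum_(0 <= r < M.+1) (b * t) ^+ r / r`!%:R)
    (\sum_(0 <= r < M) b * ((b * t) ^+ r / r`!%:R)).
  rewrite -[X in is_derive _ _ _ X]add0r.
  under eq_fun do rewrite big_nat_recl//.
  apply: is_deriveD.
    by under eq_fun do rewrite expr0; exact: is_derive_cst.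
  by apply: is_derive_sum_seq => r _; exact: is_derive_monomial.
apply: (@is_derive_eq _ _ _ _ t 1 _ _ (is_deriveB h1 h2)).
by rewrite /exp_tail big_nat_recr//= -mulr_sumr; ring.
Qed.

Lemma is_derive_damped_exp_tail a b M t :
  is_derive t 1 (fun t => expR (- a * t) * exp_tail b M t)
   (b * (expR (- a * t) * ((b * t) ^+ M / M`!%:R))
    - (a - b) * (expR (- a * t) * exp_tail b M t)).
Proof.
apply: (@is_derive_eq _ _ _ _ t 1 _ _
  (is_deriveM (is_derive_expR_linear (- a) t) (is_derive_exp_tail b M t))).
by rewrite /GRing.scale/=; ring.
Qed.

(** Kolmogorov's forward equations of the pure death process started in m with
    death rates rate, restricted to the states l with j <= l <= m. The
    restriction makes sense because state l is entered from l.+1 only. *)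
Definition forward_equations (rate : nat -> R) m j (q : nat -> R -> R) :=
  forall l, (j <= l <= m)%N -> q l 0 = (l == m)%:R /\
    forall t, is_derive t 1 (q l)
      ((if (l < m)%N then rate l.+1 * q l.+1 t else 0) - rate l * q l t).

Definition service_rate mu c l : R := (minn l c)%:R * mu.

(** With at most c customers every one is in service, and each is still there at
    time t with probability expR (- mu * t) independently of the others: a
    binomial law. *)
Definition thinning_prob mu m l t : R :=
  'C(m, l)%:R * (expR (- (l%:R * mu) * t) * (1 - expR (- mu * t)) ^+ (m - l)).

Lemma forward_thinning mu c m : (m <= c)%N ->
  forward_equations (service_rate mu c) m 0 (thinning_prob mu m).
Proof.
move=> mc l /andP[_ lm]; split.
  rewrite /thinning_prob !mulr0 !expR0 subrr expr0n mul1r subn_eq0.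
  have [->|nlm] := eqVneq l m; first by rewrite binn leqnn mulr1.
  by rewrite leqNgt ltn_neqAle nlm lm mulr0.
move=> t; rewrite /service_rate (minn_idPl (leq_trans lm mc)).
have h1 := is_derive_expR_linear (- (l%:R * mu)) t.
have h3 : is_derive t 1 (fun u => 1 - expR (- mu * u)) (mu * expR (- mu * t)).
  have h := is_derive_expR_linear (- mu) t.
  by apply: is_derive_eq; ring.
have h2 := is_deriveX (m - l) h3.
have [lm'|] := ltnP l m; last first.
  move=> ml; have -> : l = m by apply/eqP; rewrite eqn_leq lm ml.
  rewrite /thinning_prob; under eq_fun do rewrite subnn expr0 binn mul1r mulr1.
  rewrite subnn expr0 binn mul1r mulr1 sub0r.
  apply: (is_derive_eq (is_derive_expR_linear (- (m%:R * mu)) t)).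
  by rewrite mulNr.
rewrite (minn_idPl (leq_trans lm' mc)).
have h := is_deriveZ 'C(m, l)%:R (is_deriveM h1 h2).
rewrite (_ : thinning_prob mu m l = 'C(m, l)%:R \*:
    ((fun u => expR (- (l%:R * mu) * u)) *
     (fun u => 1 - expR (- mu * u)) ^+ (m - l))); last first.
  by apply/funext => u; rewrite !fctE.
apply: (is_derive_eq h).
rewrite /thinning_prob !fctE /= /GRing.scale/=.
have -> : expR (- (l.+1%:R * mu) * t) = expR (- (l%:R * mu) * t) * expR (- mu * t).
  by rewrite -expRD -natr1; congr expR; ring.
rewrite subnS.
have -> : (m - l)%N = (m - l).-1.+1 by rewrite prednK ?subn_gt0.
have hb : l.+1%:R * 'C(m, l.+1)%:R = (m - l).-1.+1%:R * 'C(m, l)%:R :> R.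
  by rewrite -!natrM prednK ?subn_gt0// mul_bin_left.
move: (m - l).-1 hb => e hb.
transitivity (mu * expR (- mu * t) * expR (- (l%:R * mu) * t) *
    (1 - expR (- mu * t)) ^+ e * (l.+1%:R * 'C(m, l.+1)%:R)
  - l%:R * mu * ('C(m, l)%:R *
      (expR (- (l%:R * mu) * t) * (1 - expR (- mu * t)) ^+ e.+1)));
  last by rewrite /=; ring.
by rewrite hb /=; ring.
Qed.

Lemma forward_poisson mu c m :
  forward_equations (service_rate mu c) m c
    (fun l => poisson_weight (c%:R * mu) (m - l)).
Proof.
move=> l /andP[cl lm]; split.
  rewrite poisson_weight0 subn_eq0.
  by have [->|nlm] := eqVneq l m; rewrite ?leqnn// leqNgt ltn_neqAle nlm lm.
move=> t; rewrite /service_rate (minn_idPr cl) (minn_idPr (leq_trans cl (leqnSn l))).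
have := is_derive_poisson_weight (c%:R * mu) (m - l) t.
by rewrite subn_gt0 subnS.
Qed.

(** This is e (1 - 1) ^ (e - 1) expanded, since k 'C(e, k) = e 'C(e.-1, k.-1).
    It cancels the inhomogeneous terms in the forward equations below c. *)
Lemma alternating_binomial_mean e : (1 < e)%N ->
  \sum_(1 <= k < e.+1) (-1) ^+ (e - k) * 'C(e, k)%:R * k%:R = 0 :> R.
Proof.
case: e => [//|e] e1; rewrite big_add1 /=.
transitivity (e.+1%:R * (-1 + 1) ^+ e : R); last first.
  by rewrite addNr expr0n; case: e e1 => // e _; rewrite mulr0.
rewrite exprDn mulr_sumr big_mkord; apply: eq_bigr => i _.
rewrite subSS expr1n mulr1 -mulrA -natrM mulnC -mul_bin_diag natrM -mulr_natr.
by ring.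
Qed.

(** Coefficients of the damped tails in the mixed case. In this binomial form the
    forward equations reduce to absorption identities for binomial
    coefficients. *)
Definition mixed_coef c M l k : R :=
  (-1) ^+ (c - l - k) * 'C(c, l)%:R * 'C(c - l, k)%:R * (c%:R / k%:R) ^+ M.

(** State probabilities started from m > c customers: Poisson as long as all
    servers are busy, a combination of damped exponential tails afterwards. *)
Definition mixed_prob mu c m l t : R :=
  if (c <= l)%N then poisson_weight (c%:R * mu) (m - l) t else
  \sum_(1 <= k < (c - l).+1) mixed_coef c (m - c) l k *
    (expR (- (c%:R * mu) * t) * exp_tail (k%:R * mu) (m - c) t).

(** The k-th damped tail solves a linear equation with decay rate (c - k) mu.
    Comparing this with the loss rate l mu of state l leaves the factor
    c - l - k, which turns the coefficients of state l into those of state l.+1.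
    The inhomogeneous terms are multiples of one Poisson weight; their sum
    vanishes by the alternating binomial identity, except in state c - 1, where
    it is the inflow from the Poisson states. *)
Lemma forward_mixed mu c m : (c < m)%N ->
  forward_equations (service_rate mu c) m 0 (mixed_prob mu c m).
Proof.
move=> cm l /andP[_ lm]; rewrite /mixed_prob.
have [cl|lc] := leqP c l.
  have [h0 h] := @forward_poisson mu c m l (introT andP (conj cl lm)).
  by split => // t; have := h t; rewrite (leq_trans cl (leqnSn l)).
split.
  rewrite (_ : l == m = false); last by apply/eqP; lia.
  by apply: big1_seq => k _; rewrite exp_tail0 !mulr0.
move=> t; have -> : (l < m)%N by lia.
rewrite /service_rate (minn_idPl lc) (minn_idPl (ltnW lc)).
set M := (m - c)%N; set e := (c - l)%N.
have e0 : (0 < e)%N by rewrite subn_gt0.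
have := @is_derive_sum_seq _ (index_iota 1 e.+1)
  (fun k t => mixed_coef c M l k *
    (expR (- (c%:R * mu) * t) * exp_tail (k%:R * mu) M t))
  (fun k => mixed_coef c M l k *
   (k%:R * mu * (expR (- (c%:R * mu) * t) * ((k%:R * mu * t) ^+ M / M`!%:R))
    - (c%:R * mu - k%:R * mu) * (expR (- (c%:R * mu) * t) * exp_tail (k%:R * mu) M t))) t.
move=> /(_ _)/(@is_derive_eq _ _ _ _ t 1); apply.
  by move=> k _; apply: is_deriveZ; exact: is_derive_damped_exp_tail.
(* Separate the inhomogeneous terms, the inflow and the outflow. *)
transitivity (\sum_(1 <= k < e.+1)
   ((c ^ M)%:R * 'C(c, l)%:R * mu * (expR (- (c%:R * mu) * t) * ((mu * t) ^+ M / M`!%:R)))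
    * ((-1) ^+ (e - k) * 'C(e, k)%:R * k%:R)
  - mu * (\sum_(1 <= k < e.+1) (e%:R - k%:R) * mixed_coef c M l k *
      (expR (- (c%:R * mu) * t) * exp_tail (k%:R * mu) M t))
  - l%:R * mu * (\sum_(1 <= k < e.+1) mixed_coef c M l k *
      (expR (- (c%:R * mu) * t) * exp_tail (k%:R * mu) M t))).
  rewrite !mulr_sumr -!sumrB; apply: eq_big_nat => k /andP[k1 _].
  have k0 : k%:R != 0 :> R by rewrite pnatr_eq0 -lt0n.
  have -> : c%:R * mu - k%:R * mu = (e%:R - k%:R) * mu + l%:R * mu.
    by rewrite /e natrB ?(ltnW lc)//; ring.
  rewrite /mixed_coef -/e natrX !exprMn exprVn.
  have kM0 := expf_neq0 M k0.
  field.
  by rewrite kM0 pnatr_eq0 -lt0n fact_gt0.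
congr (_ - _).
rewrite -mulr_sumr.
have [lc1|lc1] := leqP c l.+1.
  have -> : e = 1%N by rewrite /e; lia.
  rewrite !big_nat1 subnn expr0 bin1 subrr !mul0r mulr0 subr0 !mul1r !mulr1.
  have <- : l.+1 = c by lia.
  rewrite binSn/= /poisson_weight.
  have -> : (m - l.+1)%N = M by rewrite /M; lia.
  rewrite natrX -/(l.+1) !exprMn; ring.
rewrite alternating_binomial_mean ?mulr0 ?sub0r; last by rewrite /e; lia.
rewrite big_nat_recr//= subrr !mul0r addr0 -mulrN -sumrN !mulr_sumr.
have -> : (c - l.+1).+1 = e by rewrite /e; lia.
apply: eq_big_nat => k /andP[k1 ke].
have hb : l.+1%:R * 'C(c, l.+1)%:R = e%:R * 'C(c, l)%:R :> R.
  by rewrite -!natrM mul_bin_left.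
have hb2 : (e%:R - k%:R) * 'C(e, k)%:R = e%:R * 'C(e.-1, k)%:R :> R.
  by rewrite -natrB ?(ltnW ke)// -!natrM mul_bin_down.
have -> : mixed_coef c M l.+1 k =
    - ((-1) ^+ (e - k) * 'C(c, l.+1)%:R * 'C(e.-1, k)%:R *
       (c%:R / k%:R) ^+ M).
  rewrite /mixed_coef -(subnS c l).
  have -> : (c - l.+1)%N = e.-1 by rewrite /e; lia.
  have -> : (e - k)%N = (e.-1 - k).+1 by lia.
  by rewrite exprS; ring.
rewrite /mixed_coef -/e.
transitivity (- mu * ((-1) ^+ (e - k) * (e%:R * 'C(e.-1, k)%:R) *
    'C(c, l)%:R * (c%:R / k%:R) ^+ M) *
  (expR (- (c%:R * mu) * t) * exp_tail (k%:R * mu) M t)).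
  by rewrite -hb2; ring.
transitivity (- mu * ((-1) ^+ (e - k) * (e%:R * 'C(c, l)%:R) *
    'C(e.-1, k)%:R * (c%:R / k%:R) ^+ M) *
  (expR (- (c%:R * mu) * t) * exp_tail (k%:R * mu) M t)).
  by ring.
by rewrite -hb; ring.
Qed.

End ForwardEquations.

(** * The product C^a in terms of binomial coefficients *)

Lemma prod_subn_fact k : (\prod_(1 <= m < k) (k - m) = (k.-1)`!)%N.
Proof.
rewrite big_nat_rev fact_prod; case: k => [|k]; first by rewrite !big_geq.
by apply: eq_big_nat => m /andP[m1 mk]; lia.
Qed.

Lemma prod_subn_fact_shift k e : (k <= e)%N ->
  (\prod_(k.+1 <= m < e.+1) (m - k) = (e - k)`!)%N.
Proof.
move=> ke; rewrite -(add1n k) big_addn fact_prod subSn//.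
by apply: eq_bigr => m _; rewrite addnK.
Qed.

Lemma prod_subn_ffact c k e : (1 <= k <= e)%N ->
  (c * ((\prod_(1 <= m < k) (c - m)) * (c - k) *
    \prod_(k.+1 <= m < e.+1) (c - m)) = c ^_ e.+1)%N.
Proof.
move=> /andP[k1 ke]; rewrite ffact_prod -(big_mkord xpredT (fun m => c - m)%N).
rewrite [in RHS]big_ltn// subn0 [in RHS](big_cat_nat (n := k))//=; last by lia.
by rewrite [in RHS](big_ltn (m := k)) ?ltnS//; ring.
Qed.

(** Putting the factors c and c - k back into the numerators of the product makes
    it the falling factorial c ^_ e.+1, while the denominators are (k - 1)! and
    (e - k)!. *)
Lemma Ca_binomial (R : realType) c k e : (1 <= k <= e)%N -> (e < c)%N ->
  (c - k)%:R * Ca R c k e * c%:R / (c - e)%:R =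
  'C(c, c - e)%:R * 'C(e, k)%:R * k%:R.
Proof.
move=> /andP[k1 ke] ec; rewrite /Ca !prodf_div.
rewrite -!natr_prod prod_subn_fact prod_subn_fact_shift// bin_sub ?(ltnW ec)//.
have hff : c%:R * ((\prod_(1 <= m < k) (c - m))%N%:R * (c - k)%:R *
    (\prod_(k.+1 <= m < e.+1) (c - m))%N%:R) = (c ^_ e)%:R * (c - e)%:R :> R.
  by rewrite -!natrM prod_subn_ffact ?k1// ffactnSr.
have hb : (c ^_ e)%:R = 'C(c, e)%:R * 'C(e, k)%:R *
    (k%:R * (k.-1)`!%:R * (e - k)`!%:R) :> R.
  rewrite -!natrM -bin_ffact -mulnA; congr (_ * _)%:R.
  by rewrite -(bin_fact ke) (_ : k`! = k * (k.-1)`!)%N//; case: (k) k1.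
have nz (n : nat) : (0 < n)%N -> n%:R != 0 :> R by rewrite pnatr_eq0 lt0n.
have ce0 := nz _ (etrans (subn_gt0 _ _) ec).
transitivity (c%:R * ((\prod_(1 <= m < k) (c - m))%N%:R * (c - k)%:R *
    (\prod_(k.+1 <= m < e.+1) (c - m))%N%:R) /
  ((k.-1)`!%:R * (e - k)`!%:R * (c - e)%:R) : R).
  by field; rewrite ce0 !nz ?fact_gt0.
rewrite hff hb; field.
by rewrite ce0 !nz ?fact_gt0.
Qed.

Lemma mixed_coefE (R : realType) c j i k : (0 < j < c)%N -> (c <= i)%N ->
  (1 <= k <= c - j)%N ->
  mixed_coef R c (i.+1 - c) j k =
  (-1) ^+ (c - j - k) * (c - k)%N%:R * Ca R c k (c - j) / j%:R *
          (c%:R / k%:R) ^+ (i - c + 2).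
Proof.
move=> /andP[j0 jc] ci kcj; have ec : (c - j < c)%N by lia.
have := Ca_binomial R kcj ec; rewrite subKn ?(ltnW jc)// => h.
have k0 : k%:R != 0 :> R by rewrite pnatr_eq0; lia.
have j0' : j%:R != 0 :> R by rewrite pnatr_eq0; lia.
rewrite /mixed_coef (_ : i - c + 2 = (i.+1 - c).+1)%N; last by lia.
rewrite [in RHS]exprSr.
transitivity ((-1) ^+ (c - j - k) * ((c - k)%:R * Ca R c k (c - j) * c%:R / j%:R) / k%:R *
    (c%:R / k%:R) ^+ (i.+1 - c) : R); last by field; rewrite k0 j0'.
by rewrite h; field.
Qed.

(** * Laplace-Stieltjes transforms and weighted moments *)

Section Transform.
Context (R : realType) (A : probability (measurableTypeR R) R).
Implicit Types (s t : R) (n : nat).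

Definition moment n s : R :=
  \int[A]_(t in `[0%R, +oo[) (t ^+ n * expR (- (s * t))).

(** With y = s t / (n + 1) one has t = (n + 1) y / s, and y ^ n is at most
    expR y ^ n.+1 = expR (s t). *)
Lemma expR_monomial_bound n s t : 0 < s -> 0 <= t ->
  t ^+ n * expR (- (s * t)) <= (n.+1%:R / s) ^+ n.
Proof.
move=> s0 t0; rewrite expRN ler_pdivrMr ?expR_gt0//.
set N : R := n.+1%:R; have N0 : N != 0 by rewrite pnatr_eq0.
set y := s * t / N.
have y0 : 0 <= y by rewrite divr_ge0 ?mulr_ge0// ltW.
have -> : expR (s * t) = expR y ^+ n.+1.
  by rewrite -expRM_natl; congr expR; rewrite -mulr_natl -/N /y; field; rewrite nat1r.
have -> : t = N / s * y.
  rewrite /y; field.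
  by rewrite nat1r N0 gt_eqF.
rewrite exprMn ler_wpM2l ?exprn_ge0 ?divr_ge0 ?(ltW s0)//.
have y1 : 1 <= expR y by rewrite -expR0 ler_expR.
apply: (@le_trans _ _ (expR y ^+ n)); last by rewrite ler_weXn2l.
by rewrite lerXn2r ?nnegrE ?expR_ge0//; apply: le_trans (expR_ge1Dx _); rewrite lerDr.
Qed.

Lemma measurable_monomial_expR n s (D : set (measurableTypeR R)) :
  measurable_fun D (fun t : measurableTypeR R => t ^+ n * expR (- (s * t)) : R).
Proof.
apply: measurable_funTS; apply: measurable_funM; first exact: measurable_funX.
apply: measurableT_comp => //; apply: measurableT_comp => //.
Qed.

Lemma integrable_bounded (f : measurableTypeR R -> R) (M : R) :
  measurable_fun (`[0%R, +oo[%classic : set (measurableTypeR R)) f ->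
  (forall t, 0 <= t -> `|f t| <= M) -> A.-integrable `[0%R, +oo[ (EFin \o f).
Proof.
move=> mf fM; apply: (@le_integrable _ _ _ _ _ _ _ (cst M%:E)) => //.
- exact/measurable_EFinP.
- move=> t; rewrite /= in_itv/= andbT => t0; rewrite lee_fin.
  by rewrite (le_trans (fM _ t0))// ler_norm.
- exact: finite_measure_integrable_cst.
Qed.

Lemma integrable_moment n s : 0 < s ->
  A.-integrable `[0%R, +oo[ (EFin \o (fun t => t ^+ n * expR (- (s * t)))).
Proof.
move=> s0; apply: (@integrable_bounded _ ((n.+1%:R / s) ^+ n)).
  exact: measurable_monomial_expR.
move=> t t0; rewrite ger0_norm ?mulr_ge0 ?exprn_ge0 ?expR_ge0//.
exact: expR_monomial_bound.
Qed.

Lemma integrable_transform s : 0 <= s ->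
  A.-integrable `[0%R, +oo[ (EFin \o (fun t => expR (- (s * t)))).
Proof.
move=> s0; apply: (@integrable_bounded _ 1).
  rewrite (_ : (fun t => _) = fun t => t ^+ 0 * expR (- (s * t))).
    exact: measurable_monomial_expR.
  by apply/funext => t; rewrite expr0 mul1r.
move=> t t0; rewrite ger0_norm ?expR_ge0// -expR0 ler_expR oppr_le0.
exact: mulr_ge0.
Qed.

Lemma LSTE s : LST A s = moment 0 s.
Proof. by apply: eq_Rintegral => t _; rewrite expr0 mul1r. Qed.

Lemma is_derive_kernel n s t :
  is_derive s 1 (fun u => t ^+ n * expR (- (u * t)))
    (- (t ^+ n.+1 * expR (- (s * t)))).
Proof.
have h := is_derive_expR_linear (- t) s.
have -> : (fun u => t ^+ n * expR (- (u * t))) = t ^+ n \*: (fun u => expR (- t * u)).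
  by apply/funext => u; rewrite /= mulNr (mulrC t u).
apply: (is_derive_eq (is_deriveZ _ h)).
by rewrite /GRing.scale/= !mulNr (mulrC t s) exprSr mulrN mulrA.
Qed.

(** Differentiation under the integral sign. On the neighbourhood ]s / 2, 2 s[
    the derivative of the integrand is bounded by a constant, which is
    integrable for a probability measure. *)
Lemma is_derive_moment n s : 0 < s ->
  is_derive s 1 (moment n) (- moment n.+1 s).
Proof.
move=> s0.
pose f u t := t ^+ n * expR (- (u * t)) : R.
have dE u t : partial1of2 f u t = - (t ^+ n.+1 * expR (- (u * t))).
  by rewrite partial1of2E; apply: derive_val; exact: is_derive_kernel.
pose M : R := (n.+2%:R / (s / 2)) ^+ n.+1.
have s20 : 0 < s / 2 by rewrite divr_gt0.
have Is : `]s / 2, s * 2[%classic s.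
  by rewrite /= in_itv/=; apply/andP; split; lra.
have intf u : `]s / 2, s * 2[%classic u -> A.-integrable `[0%R, +oo[ (EFin \o f u).
  rewrite /= in_itv/= => /andP[su _]; apply: integrable_moment.
  exact: lt_trans su.
have df u t : `]s / 2, s * 2[%classic u -> `[0%R, +oo[%classic t ->
    derivable (f ^~ t) u 1.
  by move=> _ _; have [] := is_derive_kernel n u t.
have M0 (t : measurableTypeR R) : 0 <= cst M t.
  by rewrite /M/= exprn_ge0// divr_ge0// ltW.
have intM : A.-integrable `[0%R, +oo[ (EFin \o cst M).
  exact: finite_measure_integrable_cst.
have fM u t : `]s / 2, s * 2[%classic u -> `[0%R, +oo[%classic t ->
    `|partial1of2 f u t| <= cst M t.
  rewrite /= !in_itv/= andbT => /andP[su _] t0; rewrite dE normrN.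
  rewrite ger0_norm ?mulr_ge0 ?exprn_ge0 ?expR_ge0//.
  apply: le_trans (expR_monomial_bound _ s20 t0).
  by rewrite ler_wpM2l ?exprn_ge0// ler_expR lerN2 ler_wpM2r// ltW.
have mD : measurable (`[0%R, +oo[%classic : set (measurableTypeR R)) by [].
apply: DeriveDef.
  exact: (derivable_under_integral mD Is intf df M0 intM fM).
rewrite -derive1E.
rewrite [LHS](differentiation_under_integral mD Is intf df M0 intM fM).
under eq_Rintegral do rewrite dE -mulN1r.
by rewrite RintegralZl ?mulN1r//; exact: integrable_moment.
Qed.

Lemma derive1n_LST n s : 0 < s -> derive1n n (LST A) s = (-1) ^+ n * moment n s.
Proof.
elim: n s => [|n IH] s s0; first by rewrite derive1n0 expr0 mul1r LSTE.
rewrite derive1nS derive1E.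
rewrite (@near_eq_derive _ _ _ _ ((-1) ^+ n \*: moment n)); last first.
  by near=> u; rewrite IH//; near: u; exact: lt_nbhsr.
rewrite (derive_val (is_derive := is_deriveZ _ (is_derive_moment n s0))).
by rewrite /GRing.scale/= exprSr mulrN mulrN1 mulNr.
Unshelve. all: by end_near. Qed.

Lemma LSTnE n s : 0 < s -> LSTn A n s = moment n s.
Proof.
by move=> s0; rewrite /LSTn derive1n_LST// mulrA -expr2 sqrr_sign mul1r.
Qed.


Lemma integrable_lincomb (I : eqType) (r : seq I) (c : I -> R)
    (f : I -> R -> R) :
  (forall i, i \in r -> A.-integrable `[0%R, +oo[ (EFin \o f i)) ->
  A.-integrable `[0%R, +oo[ (EFin \o (fun t => \sum_(i <- r) c i * f i t)).
Proof.
elim: r => [|i r IH] fi.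
  rewrite (_ : _ \o _ = cst 0%E); first exact: integrable0.
  by apply/funext => t /=; rewrite big_nil.
rewrite (_ : _ \o _ = (fun t => (c i)%:E * (EFin \o f i) t +
    (EFin \o (fun t => (\sum_(i <- r) c i * f i t)%R)) t)%E); last first.
  by apply/funext => t /=; rewrite big_cons EFinD EFinM.
apply: integrableD => //.
  by apply: integrableZl => //; apply: fi; rewrite mem_head.
by apply: IH => j jr; apply: fi; rewrite in_cons jr orbT.
Qed.

Lemma Rintegral_lincomb (I : eqType) (r : seq I) (c : I -> R)
    (f : I -> R -> R) :
  (forall i, i \in r -> A.-integrable `[0%R, +oo[ (EFin \o f i)) ->
  \int[A]_(t in `[0%R, +oo[) (\sum_(i <- r) c i * f i t) =
  \sum_(i <- r) c i * \int[A]_(t in `[0%R, +oo[) f i t.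
Proof.
elim: r => [|i r IH] fi.
  rewrite big_nil; under eq_Rintegral do rewrite big_nil.
  by rewrite Rintegral_cst// mul0r.
have fi0 : A.-integrable `[0%R, +oo[ (EFin \o f i) by apply: fi; rewrite mem_head.
have fr j : j \in r -> A.-integrable `[0%R, +oo[ (EFin \o f j).
  by move=> jr; apply: fi; rewrite in_cons jr orbT.
rewrite big_cons; under eq_Rintegral do rewrite big_cons.
rewrite RintegralD//; last 2 first.
- rewrite (_ : _ \o _ = (fun t => (c i)%:E * (EFin \o f i) t)%E).
    exact: integrableZl.
  by apply/funext => t /=; rewrite EFinM.
- exact: integrable_lincomb.
by rewrite RintegralZl// IH.
Qed.

Lemma integral_thinning_prob mu m l : 0 < mu -> (l <= m)%N ->
  \int[A]_(t in `[0%R, +oo[) thinning_prob mu m l t =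
  'C(m, m - l)%:R * \sum_(0 <= r < (m - l).+1)
     (-1) ^+ r * 'C(m - l, r)%:R * LST A ((l + r)%N%:R * mu).
Proof.
move=> mu0 lm; rewrite bin_sub//.
transitivity (\int[A]_(t in `[0%R, +oo[) \sum_(0 <= r < (m - l).+1)
   ('C(m, l)%:R * ((-1) ^+ r * 'C(m - l, r)%:R)) * expR (- ((l + r)%N%:R * mu * t))).
  apply: eq_Rintegral => t _; rewrite /thinning_prob exprBn !mulr_sumr big_mkord.
  apply: eq_bigr => r _; rewrite expr1n mulr1 -mulr_natr.
  rewrite (_ : expR (- mu * t) ^+ r = expR (- (r%:R * mu * t))); last first.
    by rewrite -expRM_natl; congr expR; ring.
  rewrite (_ : expR (- ((l + r)%N%:R * mu * t)) =
      expR (- (l%:R * mu) * t) * expR (- (r%:R * mu * t))); last first.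
    by rewrite -expRD natrD; congr expR; ring.
  by ring.
rewrite Rintegral_lincomb; last first.
  by move=> r _; apply: integrable_transform; rewrite mulr_ge0// ltW.
by rewrite mulr_sumr; apply: eq_bigr => r _; rewrite [RHS]mulrA.
Qed.

Lemma integral_poisson_weight a k : 0 < a ->
  \int[A]_(t in `[0%R, +oo[) poisson_weight a k t = a ^+ k * LSTn A k a / k`!%:R.
Proof.
move=> a0; rewrite LSTnE// /moment.
transitivity (\int[A]_(t in `[0%R, +oo[)
  ((a ^+ k / k`!%:R) * (t ^+ k * expR (- (a * t))))).
  by apply: eq_Rintegral => t _; rewrite /poisson_weight exprMn mulNr; ring.
rewrite RintegralZl//; last exact: integrable_moment.
by rewrite mulrAC.
Qed.

Lemma damped_exp_tailE a b M t :
  expR (- a * t) * exp_tail b M t = expR (- ((a - b) * t)) -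
    \sum_(0 <= r < M.+1) (b ^+ r / r`!%:R) * (t ^+ r * expR (- (a * t))).
Proof.
rewrite /exp_tail mulrBr -expRD mulr_sumr; congr (expR _ - _); first by ring.
by apply: eq_bigr => r _; rewrite exprMn mulNr; ring.
Qed.

Lemma integrable_damped_exp_tail a b M : 0 < a -> b <= a ->
  A.-integrable `[0%R, +oo[
    (EFin \o (fun t => expR (- a * t) * exp_tail b M t)).
Proof.
move=> a0 ba.
rewrite (_ : _ \o _ = (fun t => (EFin \o (fun t => expR (- ((a - b) * t)))) t -
    (EFin \o (fun t => \sum_(0 <= r < M.+1)
       (b ^+ r / r`!%:R) * (t ^+ r * expR (- (a * t)))))%R t)%E); last first.
  by apply/funext => t /=; rewrite -EFinB damped_exp_tailE.
apply: integrableB => //.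
  by apply: integrable_transform; rewrite subr_ge0.
by apply: integrable_lincomb => r _; exact: integrable_moment.
Qed.

Lemma integral_damped_exp_tail a b M : 0 < a -> b <= a ->
  \int[A]_(t in `[0%R, +oo[) (expR (- a * t) * exp_tail b M t) =
  LST A (a - b) - \sum_(0 <= r < M.+1) b ^+ r * LSTn A r a / r`!%:R.
Proof.
move=> a0 ba.
transitivity (\int[A]_(t in `[0%R, +oo[) (expR (- ((a - b) * t)) -
    \sum_(0 <= r < M.+1) (b ^+ r / r`!%:R) * (t ^+ r * expR (- (a * t))))).
  by apply: eq_Rintegral => t _; exact: damped_exp_tailE.
have im r : r \in index_iota 0 M.+1 -> A.-integrable `[0%R, +oo[
    (EFin \o (fun t => t ^+ r * expR (- (a * t)))).
  by move=> _; exact: integrable_moment.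
rewrite RintegralB//; last 2 first.
- by apply: integrable_transform; rewrite subr_ge0.
- exact: integrable_lincomb.
rewrite Rintegral_lincomb//; congr (_ - _).
by apply: eq_bigr => r _; rewrite LSTnE// /moment; ring.
Qed.

Lemma integral_mixed_prob mu c j i : 0 < mu -> (0 < j < c)%N -> (c <= i)%N ->
  \int[A]_(t in `[0%R, +oo[) mixed_prob mu c i.+1 j t =
  \sum_(1 <= k < (c - j).+1)
    (-1) ^+ (c - j - k) * (c - k)%N%:R * Ca R c k (c - j) / j%:R *
    (c%:R / k%:R) ^+ (i - c + 2) *
    (LST A ((c - k)%N%:R * mu) -
     \sum_(0 <= r < (i - c + 1).+1)
       (k%:R * mu) ^+ r * LSTn A r (c%:R * mu) / (r`!)%:R).
Proof.
move=> mu0 /andP[j0 jc] ci; rewrite /mixed_prob leqNgt jc/=.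
have c0 : 0 < c%:R * mu by rewrite mulr_gt0// ltr0n; lia.
have kc k : k \in index_iota 1 (c - j).+1 -> (0 < k <= c)%N && (k <= c - j)%N.
  by rewrite mem_index_iota; lia.
have kcmu k : k \in index_iota 1 (c - j).+1 -> k%:R * mu <= c%:R * mu.
  by move=> /kc kc'; rewrite ler_wpM2r ?(ltW mu0)// ler_nat; lia.
rewrite Rintegral_lincomb; last first.
  by move=> k /kcmu kc'; exact: integrable_damped_exp_tail.
apply: eq_big_seq => k kP; have kck := kc _ kP.
rewrite integral_damped_exp_tail ?kcmu// mixed_coefE//; [|by lia..].
rewrite -mulrBl -natrB; last by lia.
by rewrite addn1 subSn.
Qed.

End Transform.

(** * Independence of disjoint groups of variables *)

Section Independence.
Context d (Omega : measurableType d) (R : realType) (P : probability Omega R).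

(** For fixed F the events E independent of F form a Dynkin system. *)
Lemma dynkin_independent (G : set (set Omega)) (F : set Omega) :
  setI_closed G -> G `<=` measurable -> measurable F ->
  (forall E, G E -> P (E `&` F) = (P E * P F)%E) ->
  forall E, <<s G >> E -> P (E `&` F) = (P E * P F)%E.
Proof.
move=> GI Gm mF GF.
have sGm : <<s G >> `<=` measurable.
  by apply: smallest_sub => //; exact: sigma_algebra_measurable.
apply: (@dynkin_induction _ (g_sigma_algebraType G) G) => //.
- by rewrite setTI [in RHS]probability_setT mul1e.
- move=> E /sGm mE EF.
  have -> : ~` E `&` F = F `\` E by rewrite setDE setIC.
  have PEf : P E \is a fin_num by exact: fin_num_measure.
  have PFf : P F \is a fin_num by exact: fin_num_measure.
  have -> : P (F `\` E) = (P F - P (F `&` E))%E.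
    by rewrite measureD// -ge0_fin_numE.
  rewrite (setIC F) EF [in RHS]probability_setC// muleBl//.
  by rewrite mul1e.
- move=> E mE tE EF.
  have mE' n : @measurable _ Omega (E n) by exact: (sGm _ (mE n)).
  rewrite setI_bigcupl.
  rewrite [LHS]measure_bigcup//; last 2 first.
    by move=> n _; exact: measurableI.
    by apply: trivIset_setIr.
  rewrite [in RHS]measure_bigcup//.
  rewrite -(@fineK _ (P F)) ?fin_num_measure// [RHS]muleC -nneseriesZl//.
  by apply: eq_eseriesr => n _; rewrite fineK ?fin_num_measure// muleC; exact: EF.
Qed.

Lemma sigma_algebras_independent (G1 G2 : set (set Omega)) :
  setI_closed G1 -> setI_closed G2 ->
  G1 `<=` measurable -> G2 `<=` measurable ->
  (forall E F, G1 E -> G2 F -> P (E `&` F) = (P E * P F)%E) ->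
  forall E F, <<s G1 >> E -> <<s G2 >> F -> P (E `&` F) = (P E * P F)%E.
Proof.
move=> G1I G2I G1m G2m G12 E F sE sF.
have mE : measurable E.
  have : <<s G1 >> `<=` measurable.
    by apply: smallest_sub => //; exact: sigma_algebra_measurable.
  exact.
rewrite setIC muleC.
apply: (dynkin_independent G2I G2m mE) sF => {}F GF.
rewrite setIC muleC.
apply: (dynkin_independent G1I G1m (G2m _ GF)) sE => {mE}E GE.
exact: G12.
Qed.

Variables (I : eqType) (Z : I -> Omega -> R).

(** Events fixed by finitely many variables of the subfamily S. The index list is
    allowed repetitions, which makes intersections a concatenation of lists. *)
Definition cylinders (S : set I) : set (set Omega) :=
  [set E | exists (s : seq I) (B : I -> set R),
    [/\ forall i, i \in s -> S i, forall i, measurable (B i) &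
        E = \bigcap_(i in [set` s]) Z i @^-1` B i]].

Lemma cylindersI S : setI_closed (cylinders S).
Proof.
move=> _ _ [s [B [sS mB ->]]] [s' [B' [sS' mB' ->]]].
exists (s ++ s'), (fun i => (if i \in s then B i else setT) `&`
  (if i \in s' then B' i else setT)); split.
- by move=> i; rewrite mem_cat => /orP[/sS|/sS'].
- by move=> i; apply: measurableI; case: ifP.
- apply/seteqP; split => w.
    by move=> [h h'] i /= _; split; case: ifP => // ?; [exact: h|exact: h'].
  move=> h; split => i /= is_; have := h i.
    by rewrite /= mem_cat is_ => /(_ isT)[].
  by rewrite /= mem_cat is_ orbT => /(_ isT)[].
Qed.

Lemma cylindersS S S' : S `<=` S' -> cylinders S `<=` cylinders S'.
Proof. by move=> SS' E [s [B [sS mB ->]]]; exists s, B; split => // i /sS/SS'. Qed.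

Hypothesis mZ : forall i, measurable_fun setT (Z i).

Lemma measurable_preim i B : measurable B -> measurable (Z i @^-1` B).
Proof. by move=> mB; rewrite -[X in measurable X]setTI; exact: mZ. Qed.

Lemma cylinders_measurable S : cylinders S `<=` measurable.
Proof.
move=> _ [s [B [sS mB ->]]]; apply: fin_bigcap_measurable => // i _.
exact: measurable_preim.
Qed.

Hypothesis indep : mutually_independent P Z.

Lemma cylinder_prod (s : seq I) (B : I -> set R) :
  uniq s -> (forall i, measurable (B i)) ->
  P (\bigcap_(i in [set` s]) Z i @^-1` B i) =
  (\prod_(i <- s) P (Z i @^-1` B i))%E.
Proof.
move=> us mB.
have inj : injective (tnth (in_tuple s)) by apply/tuple_uniqP.
have := indep inj (fun l => mB (tnth (in_tuple s) l)).
rewrite (big_tnth _ _ s) => <-; congr (P _).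
apply/seteqP; split => w h.
  by move=> l _; apply: h; rewrite /= mem_tnth.
by move=> i /= /(tnthP (in_tuple s))[l ->]; exact: h.
Qed.

Lemma cylinders_independent S S' : [disjoint S & S'] ->
  forall E F, cylinders S E -> cylinders S' F -> P (E `&` F) = (P E * P F)%E.
Proof.
move=> /disj_setPS SS' _ _ [s [B [sS mB ->]]] [s' [B' [sS' mB' ->]]].
have us (t : seq I) : [set` t] = [set` undup t].
  by apply/seteqP; split => i /=; rewrite mem_undup.
rewrite (us s) (us s').
have {}sS i : i \in undup s -> S i by rewrite mem_undup => /sS.
have {}sS' i : i \in undup s' -> S' i by rewrite mem_undup => /sS'.
move: (undup s) (undup s') (undup_uniq s) (undup_uniq s') sS sS' => {us}{}s {}s'.
move=> us us' sS sS'.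
have ss' i : i \in s' -> i \notin s.
  by move=> is'; apply/negP => /sS Si; apply: (SS' i); split => //; exact: sS'.
pose B'' i := if i \in s then B i else B' i.
transitivity (P (\bigcap_(i in [set` s ++ s']) Z i @^-1` B'' i)).
  congr (P _); apply/seteqP; split => w.
    move=> [h h'] i /=; rewrite mem_cat /B'' => /orP[is_|is'].
      by rewrite is_; exact: h.
    by rewrite (negbTE (ss' _ is')); exact: h'.
  move=> h; split => i /= is_; have := h i; rewrite /= mem_cat is_ ?orbT => /(_ isT).
    by rewrite /B'' is_.
  by rewrite /B'' (negbTE (ss' _ is_)).
rewrite !cylinder_prod//; last 2 first.
- rewrite cat_uniq us us' andbT/=; apply/hasPn => i; exact: ss'.
- by move=> i; rewrite /B''; case: ifP.
rewrite big_cat/=; congr (_ * _)%E; apply: eq_big_seq => i is_.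
  by rewrite /B'' is_.
by rewrite /B'' (negbTE (ss' _ is_)).
Qed.

(** The sample space with the events decided by the variables of index in S. As a
    measurable type of its own, it makes the closure properties of
    measurable functions available for tracking which variables an observable
    depends on. *)
Definition info S := g_sigma_algebraType (cylinders S).

Lemma info_measurable S (E : set Omega) :
  measurable (E : set (info S)) -> measurable E.
Proof.
move: E; apply: smallest_sub; first exact: sigma_algebra_measurable.
exact: cylinders_measurable.
Qed.

(** On the generating pi-systems of finite cylinders this is the product rule
    over the concatenation of the two index lists. *)
Lemma info_independent S S' (E F : set Omega) : [disjoint S & S'] ->
  measurable (E : set (info S)) -> measurable (F : set (info S')) ->
  P (E `&` F) = (P E * P F)%E.
Proof.
move=> SS'; apply: sigma_algebras_independent.
- exact: cylindersI.
- exact: cylindersI.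
- exact: cylinders_measurable.
- exact: cylinders_measurable.
- exact: cylinders_independent.
Qed.

Lemma info_mono S S' (E : set Omega) : S `<=` S' ->
  measurable (E : set (info S)) -> measurable (E : set (info S')).
Proof.
move=> SS'; apply: sub_smallest2r; first exact: smallest_sigma_algebra.
exact: cylindersS.
Qed.

Lemma info_preim S i B : S i -> measurable B ->
  measurable (Z i @^-1` B : set (info S)).
Proof.
move=> Si mB; apply: sub_gen_smallest; exists [:: i], (fun=> B); split => //.
  by move=> j; rewrite inE => /eqP ->.
by rewrite set_cons1 bigcap_set1.
Qed.

Lemma info_measurable_fun S i : S i ->
  measurable_fun (T := info S) setT (Z i).
Proof. by move=> Si _ B mB; rewrite setTI; exact: info_preim. Qed.

Lemma info_fun_mono S S' (f : Omega -> R) : S `<=` S' ->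
  measurable_fun (T := info S) setT f -> measurable_fun (T := info S') setT f.
Proof.
move=> SS' mf _ B mB; apply: info_mono SS' _; exact: mf.
Qed.

End Independence.

(** * Exponential laws and convolution *)

Section Density.
Context (R : realType).
Local Notation leb := (@lebesgue_measure R).

(** The density is the Radon-Nikodym derivative up to a null set, so this is a
    change of variables. *)
Lemma integral_density (nu : probability (measurableTypeR R) R) (p : R -> R)
    (f : R -> \bar R) :
  leb.-integrable setT (EFin \o p) ->
  (forall B, measurable B -> nu B = (\int[leb]_(x in B) (p x)%:E)%E) ->
  nu.-integrable setT f ->
  (\int[nu]_x f x = \int[leb]_x (f x * (p x)%:E))%E.
Proof.
move=> ip nuE fint.
have dom : nu `<< leb.
  apply/null_content_dominatesP => B mB B0; rewrite nuE//.
  apply: null_set_integral => //.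
  by apply: (measurable_int leb); exact: (@integrableS _ _ _ leb setT B).
rewrite -(Radon_Nikodym_change_of_variables dom)//=.
have mf := measurable_int _ fint.
apply: ae_eq_integral => //.
- exact: emeasurable_funM.
- by apply: emeasurable_funM => //; exact: measurable_int ip.
apply: ae_eqe_mul2l => /=.
apply: integral_ae_eq => //=.
- exact: Radon_Nikodym_integrable.
- exact: measurable_int ip.
- move=> E _ mE; rewrite -Radon_Nikodym_integral//.
  exact: nuE.
Qed.

End Density.

Section JointLaw.
Context d (Omega : measurableType d) (R : realType) (P : probability Omega R).

(** The law of the pair agrees with the product measure on rectangles, hence
    everywhere, and the product measure integrates sections. *)
Lemma independent_joint_law d1 d2 (T1 : measurableType d1)
    (T2 : measurableType d2) (X : {RV P >-> T1}) (Y : {RV P >-> T2})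
    (C : set (T1 * T2)) :
  (forall A B, measurable A -> measurable B ->
    P (X @^-1` A `&` Y @^-1` B) = (P (X @^-1` A) * P (Y @^-1` B))%E) ->
  measurable C ->
  P [set w | C (X w, Y w)] =
  (\int[distribution P Y]_y distribution P X (ysection C y))%E.
Proof.
move=> XY mC.
have mXY : measurable_fun setT (fun w => (X w, Y w)).
  by apply/measurable_fun_pairP; split; exact: measurable_funP.
pose XYm : {mfun Omega >-> (T1 * T2)%type} :=
  HB.pack (fun w => (X w, Y w)) (isMeasurableFun.Build _ _ _ _ _ mXY).
have u := @product_measure_unique _ _ _ _ R (distribution P X) (distribution P Y).
transitivity (distribution P XYm C) => //.
rewrite -(u (distribution P XYm))//.
apply: (u (distribution P X \x^ distribution P Y)%E) => // A B mA mB.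
exact: product_measure2E.
Qed.

End JointLaw.

Section Exponential.
Context (R : realType).
Implicit Types r t : R.
Local Notation leb := (@lebesgue_measure R).

Lemma exponential_prob_gt r t : 0 < r -> 0 <= t ->
  exponential_prob r `]t, +oo[ = (expR (- r * t))%:E.
Proof.
move=> r0 t0; rewrite /exponential_prob integral_itv_obnd_cbnd; last first.
  by apply/measurable_EFinP/measurable_funTS; exact: measurable_exponential_pdf.
rewrite (@ge0_continuous_FTC2y _ _ (fun x => - (expR (- r * x))) _ 0)//.
- by rewrite -EFinN opprK add0e.
- by move=> x _; apply: exponential_pdf_ge0; exact: ltW.
- apply: (@continuous_subspaceW R^o _ _ [set` `[0, +oo[%R]).
    by apply: subset_itvr; rewrite bnd_simp.
  exact: within_continuous_exponential_pdf.
- rewrite -oppr0; apply: cvgN.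
  rewrite (_ : (fun x => expR (- r * x)) =
               (fun z => expR (- z)) \o (fun z => r * z)); last first.
    by apply: eq_fun => x; rewrite mulNr.
  apply: (@cvg_comp _ _ _ _ _ _ (pinfty_nbhs R)); last exact: cvgr_expR.
  exact: gt0_cvgMry.
- apply: cvgN; apply/cvg_at_right_filter.
  apply: continuous_comp; last exact: continuous_expR.
  exact: mulrl_continuous.
- move=> x; rewrite in_itv/= andbT => tx; apply: derive1_exponential_pdf.
  by rewrite in_itv/= andbT (le_lt_trans t0).
Qed.

Lemma exponential_prob_lt0 r : 0 < r -> exponential_prob r `]-oo, 0[ = 0%E.
Proof.
move=> r0; rewrite /exponential_prob integral0_eq// => x.
by rewrite /= in_itv/= => x0; rewrite lt0_exponential_pdf.
Qed.

Lemma exponential_prob_gt_lt0 r t : 0 < r -> t < 0 ->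
  exponential_prob r `]t, +oo[ = 1%E.
Proof.
move=> r0 t0; rewrite /exponential_prob -(integral_exponential_pdf r0).
rewrite [LHS]integral_mkcond; apply: eq_integral => x _; rewrite patchE.
case: ifPn => //; rewrite notin_setE/= in_itv/= andbT => /negP; rewrite -leNgt.
by move=> xt; rewrite lt0_exponential_pdf// (le_lt_trans xt).
Qed.

(** The half-lines ]t, +oo[ form a generating pi-system. *)
Lemma exponential_law_unique r (nu : probability (measurableTypeR R) R) :
  0 < r -> (forall t, nu `]t, +oo[%classic = exponential_prob r `]t, +oo[) ->
  forall B, measurable B -> nu B = exponential_prob r B.
Proof.
move=> r0 nuE B mB.
have [e eE] : exists e : {measure set (measurableTypeR R) -> \bar R},
    forall C, e C = exponential_prob r C.
  by unshelve eexists (exponential_prob r).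
rewrite -eE.
refine (@measure_unique _ R (measurableTypeR R) (@RGenOInfty.G R)
  (fun n => `]- (n%:R : R), +oo[%classic) _ _ _ _ nu e _ _ B mB).
- exact: RGenOInfty.measurableE.
- move=> _ _ [x ->] [y ->]; exists (Num.max x y).
  apply/seteqP; split => z /=; rewrite !in_itv/= !andbT gt_max.
    by move=> [-> ->].
  by move=> /andP.
- by move=> n; exists (- n%:R).
- apply/seteqP; split => // x _; exists (Num.bound `|x|) => //=.
  rewrite in_itv/= andbT ltrNl (le_lt_trans (ler_norm _))// normrN.
  exact: archi_boundP.
- by move=> _ [t ->]; rewrite eE; exact: nuE.
- by move=> n; rewrite -ge0_fin_numE// fin_num_measure.
Qed.

End Exponential.

Section Convolution.
Context d (Omega : measurableType d) (R : realType) (P : probability Omega R).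
Local Notation leb := (@lebesgue_measure R).

(** Distribution functions of nonnegative variables vanish to the left of 0 but
    the closed forms used for them do not. *)
Definition on_nonneg (G : R -> R) (t : R) : R := if 0 <= t then G t else 0.

Lemma ysection_add_le (t y : R) :
  ysection [set z : measurableTypeR R * measurableTypeR R | z.1 + z.2 <= t] y =
  `]-oo, (t - y)]%classic.
Proof.
by apply/seteqP; split => x; rewrite /ysection /= inE/= in_itv/= lerBrDr.
Qed.

Lemma measurable_add_le (t : R) :
  measurable [set z : measurableTypeR R * measurableTypeR R | z.1 + z.2 <= t].
Proof.
have h : measurable_fun setT
    (fun z : measurableTypeR R * measurableTypeR R => (z.1 + z.2 : R)).
  by apply: measurable_funD; [exact: measurable_fst|exact: measurable_snd].
have := h measurableT _ (measurable_itv `]-oo, t]).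
by rewrite setTI; congr measurable; apply/seteqP; split => z; rewrite /= in_itv.
Qed.

Lemma is_derive_reflect (H : R -> R) (dH : R -> R) (t y : R) :
  (forall u : R, is_derive u 1 H (dH u)) ->
  is_derive y 1 (fun u => H (t - u)) (- dH (t - y)).
Proof.
move=> hH.
have h : is_derive y 1 (fun u : R => t - u) (-1).
  apply: (is_derive_eq (is_deriveB (is_derive_cst t y 1) (is_derive_id y 1))).
  by rewrite sub0r.
by rewrite -mulrN1; exact: (is_derive1_comp (hH _) h).
Qed.

Lemma is_derive_continuous (H : R -> R) (dH : R -> R) :
  (forall u : R, is_derive u 1 H (dH u)) -> continuous H.
Proof.
by move=> hH u; apply: differentiable_continuous; apply/derivable1_diffP;
  have [] := hH u.
Qed.

(** By the differential equation, - H (t - y) * expR (- r * y) is an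
    antiderivative in y of the integrand. *)
Lemma convolution_integral (r : R) (G H : R -> R) (t : R) :
  0 < t -> continuous G ->
  (forall u : R, is_derive u 1 H (r * (G u - H u))) -> H 0 = 0 ->
  (\int[leb]_(y in `[0%R, t]) (G (t - y) * (r * expR (- r * y)))%:E = (H t)%:E)%E.
Proof.
move=> t0 cG dH H0.
pose F y := - H (t - y) * expR (- r * y).
have dF (y : R) : is_derive y 1 F (G (t - y) * (r * expR (- r * y))).
  have h1 := is_deriveN (is_derive_reflect t y dH).
  have h2 : is_derive y 1 (fun u : R => expR (- r * u)) (- r * expR (- r * y)).
    exact: is_derive_expR_linear.
  apply: (is_derive_eq (is_deriveM h1 h2)).
  by rewrite /GRing.scale/= !fctE; ring.
rewrite (@continuous_FTC2 _ _ F)//.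
- by rewrite /F subrr subr0 H0 oppr0 mul0r sub0e mulr0 expR0 mulr1 EFinN oppeK.
- apply: continuous_subspaceT => y.
  apply: (@continuousM _ R^o (fun y => G (t - y)) (fun y => r * expR (- r * y))).
    apply: (@continuous_comp _ _ _ (fun y => t - y) G); last exact: cG.
    by apply: continuousB; [exact: cst_continuous|].
  apply: (@continuousM _ R^o (cst r)); first exact: cst_continuous.
  apply: (is_derive_continuous (is_derive_expR_linear (- r))).
- have cF := is_derive_continuous dF.
  split.
  + by move=> y _; have [] := dF y.
  + by apply: cvg_at_right_filter; exact: cF.
  + by apply: cvg_at_left_filter; exact: cF.
- by move=> y _; rewrite derive1E; apply: derive_val.
Qed.

(** Adding an independent exponential delay to a nonnegative variable turns its
    distribution function G into the solution H of H' = r (G - H), H 0 = 0. *)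
Lemma cdf_add_exponential (r : R) (X Y : {RV P >-> measurableTypeR R}) (G H : R -> R) :
  0 < r ->
  (forall A B, measurable A -> measurable B ->
    P (X @^-1` A `&` Y @^-1` B) = (P (X @^-1` A) * P (Y @^-1` B))%E) ->
  (forall B, measurable B -> P (Y @^-1` B) = exponential_prob r B) ->
  (forall t, P [set w | X w <= t] = (on_nonneg G t)%:E) ->
  continuous G -> (forall t : R, is_derive t 1 H (r * (G t - H t))) -> H 0 = 0 ->
  forall t, P [set w | X w + Y w <= t] = (on_nonneg H t)%:E.
Proof.
move=> r0 XY Yexp Xcdf cG dH H0 t.
rewrite (independent_joint_law XY (measurable_add_le t)).
have gE y : distribution P X (ysection
      [set z : measurableTypeR R * measurableTypeR R | z.1 + z.2 <= t] y) =
    (on_nonneg G (t - y))%:E.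
  rewrite ysection_add_le -Xcdf /distribution /pushforward; exact: congr1.
have mg := measurable_fun_ysection (distribution P X) (measurable_add_le t).
have ig : (distribution P Y).-integrable setT (fun y => distribution P X
    (ysection [set z : measurableTypeR R * measurableTypeR R | z.1 + z.2 <= t] y)).
  apply: (@le_integrable _ _ _ _ _ measurableT _ (cst 1%E)) => //.
    by move=> y _; rewrite gee0_abs//= normr1; apply: probability_le1;
      exact: measurable_ysection (measurable_add_le t).
  exact: finite_measure_integrable_cst.
rewrite (integral_density (integrable_exponential_pdf r0) _ ig); last exact: Yexp.
under eq_integral do rewrite gE -EFinM.
have pE y : on_nonneg G (t - y) * exponential_pdf r y =
   ((fun y => G (t - y) * (r * expR (- r * y))) \_ `[0, t]) y.
  rewrite patchE /on_nonneg subr_ge0.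
  have [yt|yt] := leP y t.
    case: ifPn; rewrite ?inE ?notin_setE/= in_itv/= yt andbT.
      by move=> y0; rewrite exponential_pdfE.
    by move=> /negP; rewrite -ltNge => y0; rewrite lt0_exponential_pdf// mulr0.
  by rewrite mul0r ifF//; apply/negP; rewrite inE/= in_itv/= (leNgt y) yt andbF.
transitivity (\int[leb]_(y in `[0%R, t])
    (G (t - y) * (r * expR (- r * y)))%:E)%E.
  rewrite [RHS]integral_mkcond; apply: eq_integral => y _.
  by rewrite pE !patchE; case: ifP.
rewrite /on_nonneg.
have [t0|] := leP 0 t; last first.
  by move=> t0; rewrite set_itv_ge ?integral_set0// bnd_simp -ltNge.
move: t0; rewrite le_eqVlt => /predU1P[<-|t0]; last exact: convolution_integral.
by rewrite set_itv1 integral_set1 H0.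
Qed.

End Convolution.

(** * Survival functions of the death process *)

Section Survival.
Variables (R : realType) (rate : nat -> R) (m j : nat) (q : nat -> R -> R).
Hypotheses (jm : (j <= m)%N) (hq : forward_equations rate m j q).

(** The probability that at least k deaths have occurred by time t. Taking
    the complement makes the sum run over the states above m - k, so that the
    forward equations of higher states suffice. *)
Definition survival k (t : R) : R := 1 - \sum_(i < k) q (m - i) t.

Lemma survival_diff k t : survival k t - survival k.+1 t = q (m - k) t.
Proof. by rewrite /survival big_ord_recr/=; ring. Qed.

Lemma survivalS0 k : (k <= m - j)%N -> survival k.+1 0 = 0.
Proof.
move=> kmj; rewrite /survival big_ord_recl/= subn0.
rewrite (hq _).1; last by rewrite jm leqnn.
rewrite eqxx big1 ?addr0 ?subrr// => i _.
rewrite /bump/= add1n (hq _).1; last by have := ltn_ord i; lia.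
by rewrite (_ : _ == m = false)//; apply/eqP; have := ltn_ord i; lia.
Qed.

(** In the sum of the forward equations over the top k.+1 states all flows between
    them cancel, and only the outflow from state m - k is left. In terms of
    survival functions this is the equation of a convolution with an exponential
    law. *)
Lemma is_derive_survival k (t : R) : (k <= m - j)%N ->
  is_derive t 1 (survival k.+1)
    (rate (m - k) * (survival k t - survival k.+1 t)).
Proof.
rewrite survival_diff; elim: k => [|k IH] kmj.
  have [_ /(_ t) h] := hq (l := m) (introT andP (conj jm (leqnn m))).
  rewrite ltnn in h.
  rewrite (_ : survival 1 = cst 1 - q m); last first.
    by apply/funext => u; rewrite /survival big_ord_recr big_ord0/= add0r subn0 !fctE.
  apply: (is_derive_eq (is_deriveB (is_derive_cst (1 : R) t 1) h)).
  by rewrite subn0; ring.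
have [_ /(_ t) h] := hq (l := (m - k.+1)%N) (ltac:(lia)).
have e : (m - k.+1).+1 = (m - k)%N by lia.
rewrite e leq_subr in h.
rewrite (_ : survival k.+2 = survival k.+1 - q (m - k.+1)); last first.
  by apply/funext => u; rewrite !fctE -survival_diff; ring.
apply: (is_derive_eq (is_deriveB (IH (ltnW kmj)) h)).
by ring.
Qed.

Lemma continuous_survival k : (k <= (m - j).+1)%N -> continuous (survival k).
Proof.
case: k => [_|k kmj].
  rewrite (_ : survival 0 = cst 1); first exact: cst_continuous.
  by apply/funext => u; rewrite /survival big_ord0 subr0.
by apply: is_derive_continuous => u; exact: is_derive_survival.
Qed.

End Survival.

(** * The queue between two arrivals *)

(** The generic theory of independent families indexes finite subfamilies by
    lists, which needs a decidable equality on the indices. *)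
HB.instance Definition _ := gen_eqMixin source.

Section Queue.
Context d (Omega : measurableType d) (R : realType) (P : probability Omega R).
Context (A : probability (measurableTypeR R) R) (mu : R).
Variables (Q : GIMc_queue P A mu) (c : nat).
Hypotheses (hc : (0 < c)%N) (mu0 : 0 < mu).

Definition primitive (z : source) : Omega -> R :=
  match z with
  | Initial => fun w => (initial Q w)%:R
  | Interarrival n => fun w => interarrival Q n w
  | Service n m s => fun w => service Q n m s w
  end.

Lemma primitive_independent : mutually_independent P primitive.
Proof. exact: (primitives_independent Q). Qed.

Lemma measurable_primitive z : measurable_fun setT (primitive z).
Proof.
case: z => [|n|n m s]; [|exact: measurable_funP..].
apply: (measurableT_comp (f := fun k : nat => k%:R : R)) => //.
Qed.

Local Notation info := (info primitive).

Lemma measurable_big_min d' (T : measurableType d') (I : Type) (s : seq I)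
    (f0 : T -> R) (f : I -> T -> R) :
  measurable_fun setT f0 -> (forall i, measurable_fun setT (f i)) ->
  measurable_fun setT (fun w => \big[Order.min/f0 w]_(i <- s) f i w).
Proof.
move=> mf0 mf; elim: s => [|i s IH].
  by under eq_fun do rewrite big_nil.
by under eq_fun do rewrite big_cons; exact: measurable_minr.
Qed.

Definition sojourn_sources n m : set source :=
  [set z | exists s, z = Service n m s].

Lemma measurable_sojourn n m :
  measurable_fun (T := info (sojourn_sources n m)) setT (sojourn Q c n m).
Proof.
apply: measurable_big_min.
  by apply: (info_measurable_fun (i := Service n m 0)); exists 0%N.
move=> s; apply: (info_measurable_fun (i := Service n m s)).
by exists (s : nat).
Qed.

Lemma info_fun S (f : Omega -> R) :
  measurable_fun (T := info S) setT f -> measurable_fun setT f.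
Proof.
move=> mf _ B mB; apply: (info_measurable measurable_primitive (S := S)).
exact: mf.
Qed.

Definition RV_of (f : Omega -> R) (mf : measurable_fun setT f) :
    {RV P >-> measurableTypeR R} :=
  HB.pack f (isMeasurableFun.Build _ _ Omega (measurableTypeR R) f mf).

(** The minimum exceeds t when all min (m, c) independent service times do, so
    the rates add up. *)
Lemma sojourn_law n m B : (0 < m)%N -> measurable B ->
  P (sojourn Q c n m @^-1` B) = exponential_prob (service_rate mu c m) B.
Proof.
move=> m0 mB.
have K0 : (0 < minn m c)%N by rewrite leq_min m0.
have r0 : 0 < service_rate mu c m by rewrite mulr_gt0// ltr0n.
have ms := info_fun (@measurable_sojourn n m).
apply: (@exponential_law_unique _ _ (distribution P (RV_of ms))) => //.
move=> t; rewrite /distribution /pushforward/=.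
transitivity (P (\bigcap_(l in [set: 'I_(minn m c)])
      (primitive (Service n m l) @^-1` `]t, +oo[))).
  congr (P _); apply/seteqP; split => w /=; rewrite in_itv/= andbT.
    rewrite /sojourn => /bigmin_gtP[_ h] l _ /=; rewrite in_itv/= andbT.
    exact: h.
  move=> h; apply/bigmin_gtP; split; last first.
    by move=> i _; have := h i I; rewrite /= in_itv/= andbT.
  by have := h (Ordinal K0) I; rewrite /= in_itv/= andbT.
rewrite (primitive_independent (f := fun l : 'I_(minn m c) => Service n m l)
  (B := fun=> `]t, +oo[%classic)) => //; last first.
  by move=> a b [] /val_inj.
under eq_bigr do rewrite service_law//.
have [t0|t0] := leP 0 t.
  rewrite exponential_prob_gt// exponential_prob_gt// prodEFin.
  rewrite big_const_ord iter_mulr_1 -expRM_natl /service_rate; congr (expR _)%:E.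
  by ring.
by rewrite !exponential_prob_gt_lt0// big1.
Qed.

Definition completion_sources n m k : set source :=
  [set z | exists l s, (l < k)%N /\ z = Service n (m - l) s].

Lemma measurable_completion_time n m k :
  measurable_fun (T := info (completion_sources n m k)) setT
    (completion_time Q c n m k).
Proof.
apply: measurable_sum => l.
apply: info_fun_mono (@measurable_sojourn n (m - l)).
by move=> z [s ->]; exists (l : nat), s.
Qed.

Lemma independent_of_info S S' (X Y : Omega -> R) :
  [disjoint S & S'] ->
  measurable_fun (T := info S) setT X -> measurable_fun (T := info S') setT Y ->
  forall B C : set R, measurable B -> measurable C ->
  P (X @^-1` B `&` Y @^-1` C) = (P (X @^-1` B) * P (Y @^-1` C))%E.
Proof.
move=> SS' mX mY B C mB mC.
apply: (info_independent measurable_primitive primitive_independent SS').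
  by rewrite -[X in measurable X]setTI; exact: mX.
by rewrite -[X in measurable X]setTI; exact: mY.
Qed.

(** Each further completion adds an independent exponential delay of rate
    service_rate mu c (m - k), and the survival functions satisfy exactly the
    differential equation of this operation. *)
Lemma completion_time_cdf n m j (q : nat -> R -> R) k :
  (j <= m)%N -> forward_equations (service_rate mu c) m j q ->
  (k <= (m - j).+1)%N -> (k <= m)%N ->
  forall t, P [set w | completion_time Q c n m k w <= t] =
    (on_nonneg (survival m q k) t)%:E.
Proof.
move=> jm hq; elim: k => [|k IH] kmj km t.
  rewrite /completion_time /on_nonneg /survival big_ord0 subr0.
  under eq_set do rewrite big_ord0.
  case: ifPn => t0.
    by rewrite (_ : [set w | _] = setT) ?probability_setT//; apply/seteqP; split.
  by rewrite (_ : [set w | _] = set0) ?measure0//; apply/seteqP; split => w //=;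
    rewrite (negbTE t0).
have mk0 : (0 < m - k)%N by rewrite subn_gt0.
pose X := RV_of (info_fun (@measurable_completion_time n m k)).
pose Y := RV_of (info_fun (@measurable_sojourn n (m - k))).
have r0 : 0 < service_rate mu c (m - k).
  by rewrite mulr_gt0// ltr0n leq_min mk0.
transitivity (P [set w | X w + Y w <= t]).
  by congr (P _); apply/seteqP; split => w;
    rewrite /= /completion_time big_ord_recr.
apply: (cdf_add_exponential (G := survival m q k) r0).
- apply: (@independent_of_info (completion_sources n m k)
    (sojourn_sources n (m - k))).
  + by apply/disj_setPS => z [[l [s [lk ->]]] [s' [e _]]]; lia.
  + exact: measurable_completion_time.
  + exact: measurable_sojourn.
- by move=> B mB; exact: sojourn_law.
- by move=> u; apply: IH => //; exact: ltnW.
- exact: (continuous_survival jm hq (ltnW kmj)).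
- by move=> u; exact: (is_derive_survival jm hq).
- exact: (survivalS0 jm hq).
Qed.

Lemma completed_leq n m w : (completed Q c n m w <= m)%N.
Proof. by rewrite /completed (leq_trans (max_card _))// card_ord. Qed.

Lemma completion_time_homo n m w :
  (forall l, (l < m)%N -> 0 <= sojourn Q c n (m - l) w) ->
  forall k k', (k <= k' <= m)%N ->
  completion_time Q c n m k w <= completion_time Q c n m k' w.
Proof.
move=> s0 k k' /andP[kk' k'm]; rewrite /completion_time.
rewrite -!(big_mkord xpredT (fun l => sojourn Q c n (m - l) w)).
rewrite (big_cat_nat _ kk')//= lerDl.
rewrite big_nat; apply: sumr_ge0 => l /andP[_ lk'].
by apply: s0; exact: leq_trans k'm.
Qed.

(** Completion times are increasing when sojourns are nonnegative, so the count of
    those not exceeding the inter-arrival time is at least k when the k-th one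
    does not exceed it. *)
Lemma leq_completed n m k w : (k <= m)%N -> 0 <= interarrival Q n w ->
  (forall l, (l < m)%N -> 0 <= sojourn Q c n (m - l) w) ->
  (k <= completed Q c n m w)%N =
  (completion_time Q c n m k w <= interarrival Q n w).
Proof.
move=> km T0 s0; apply/idP/idP => [|kT].
  apply: contraTT; rewrite -ltNge -ltnNge => Tk.
  case: k km Tk => [_|k km Tk].
    by rewrite /completion_time big_ord0 ltNge T0.
  rewrite ltnS /completed.
  apply: (@leq_trans #|[set i : 'I_m | (i < k)%N]%SET|).
    apply: subset_leq_card; apply/fintype.subsetP => i; rewrite !inE.
    apply: contraTT; rewrite -leqNgt -ltNge => ki.
    by apply: lt_le_trans Tk _; apply: completion_time_homo => //;
      rewrite ltnS ki ltn_ord.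
  rewrite -sum1dep_card -(big_ord_widen _ (fun=> 1%N) (ltnW km)).
  by rewrite sum1_card card_ord.
have -> : k = #|[set i : 'I_m | (i < k)%N]%SET|.
  rewrite -sum1dep_card -(big_ord_widen _ (fun=> 1%N) km).
  by rewrite sum1_card card_ord.
apply: subset_leq_card; apply/fintype.subsetP => i; rewrite !inE => ik.
by apply: le_trans kT; apply: completion_time_homo => //; rewrite ik.
Qed.

Hypothesis hA : A [set t : R | 0 <= t] = 1%E.

Lemma ae_interarrival_ge0 n : {ae P, forall w, 0 <= interarrival Q n w}.
Proof.
exists (interarrival Q n @^-1` (~` [set t : R | 0 <= t])).
have mC : measurable [set t : R | 0 <= t].
  rewrite (_ : [set t | _] = `[0, +oo[%classic)//.
  by apply/seteqP; split => t; rewrite /= in_itv/= andbT.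
split.
- rewrite -[X in measurable X]setTI; apply: measurable_funP => //.
  exact: measurableC.
- rewrite interarrival_law//; last exact: measurableC.
  by rewrite probability_setC// hA subee.
- by [].
Qed.

Lemma ae_sojourn_ge0 n m : (0 < m)%N -> {ae P, forall w, 0 <= sojourn Q c n m w}.
Proof.
move=> m0; exists (sojourn Q c n m @^-1` `]-oo, 0[); split.
- by rewrite -[X in measurable X]setTI; apply: (info_fun (@measurable_sojourn n m)).
- rewrite sojourn_law// exponential_prob_lt0//.
  by rewrite mulr_gt0// ltr0n leq_min m0.
- by move=> w /negP; rewrite -ltNge /= in_itv.
Qed.

Lemma measure_ae_eq (E F : set Omega) : measurable E -> measurable F ->
  {ae P, forall w, E w <-> F w} -> P E = P F.
Proof.
move=> mE mF EF.
rewrite -[E]setIT -[F]setIT -!integral_indic//.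
apply: ae_eq_integral => //.
- exact/measurable_EFinP/measurable_indic.
- exact/measurable_EFinP/measurable_indic.
- apply: filterS EF => w EF _; congr (_%:E); rewrite !indicE.
  by congr (_%:R); congr nat_of_bool; apply/idP/idP; rewrite !inE; apply EF.
Qed.

Definition present n : set source := [set z | match z with
  | Initial => False | Interarrival k => k = n | Service k _ _ => k = n end].

Lemma measurable_completed n m k :
  measurable ([set w | completed Q c n m w = k] : set (info (present n))).
Proof.
pose f w : R := \sum_(i < m)
  \1_[set w | completion_time Q c n m i.+1 w <= interarrival Q n w] w.
have mf : measurable_fun (T := info (present n)) setT f.
  apply: measurable_sum => i; apply: measurable_indic.
  have mS : measurable_fun (T := info (present n)) setT
      (completion_time Q c n m i.+1).
    apply: info_fun_mono (@measurable_completion_time n m i.+1).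
    by move=> z [l [s [_ ->]]].
  have mT : measurable_fun (T := info (present n)) setT (interarrival Q n : Omega -> R).
    exact: (info_measurable_fun (i := Interarrival n)).
  rewrite -[X in measurable X]setTI; exact: measurable_fun_le.
have fE w : f w = (completed Q c n m w)%:R.
  rewrite /completed -sum1dep_card natr_sum [RHS]big_mkcond/=.
  apply: eq_bigr => i _; rewrite indicE; case: ifPn => h.
    by rewrite mem_set.
  by rewrite memNset//; exact/negP.
have := mf measurableT _ (measurable_set1 k%:R).
rewrite setTI; congr measurable; apply/seteqP; split => w /=; rewrite fE.
  by move/eqP; rewrite eqr_nat => /eqP.
by move=> ->.
Qed.

Lemma measurable_leq_completed n m k :
  measurable ([set w | (k <= completed Q c n m w)%N] : set (info (present n))).
Proof.
rewrite (_ : [set w | _] = \bigcup_(l in [set l | (k <= l)%N])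
    [set w | completed Q c n m w = l]).
  by apply: bigcup_measurable => l _; exact: measurable_completed.
apply/seteqP; split => w /=; first by move=> kw; exists (completed Q c n m w).
by move=> [l /= kl ->].
Qed.

(** Almost surely the event compares the k-th completion time with the independent
    inter-arrival time; condition on the latter. *)
Lemma prob_leq_completed n m j (q : nat -> R -> R) k :
  (j <= m)%N -> forward_equations (service_rate mu c) m j q ->
  (k <= (m - j).+1)%N -> (k <= m)%N ->
  P [set w | (k <= completed Q c n m w)%N] =
  (\int[A]_(t in `[0%R, +oo[) (survival m q k t)%:E)%E.
Proof.
move=> jm hq kmj km.
pose X := RV_of (info_fun (@measurable_completion_time n m k)).
have mT : measurable_fun setT (interarrival Q n : Omega -> R).
  exact: measurable_funP.
pose Y := RV_of mT.
transitivity (P [set w | completion_time Q c n m k w <= interarrival Q n w]).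
  apply: measure_ae_eq.
  - apply: (info_measurable measurable_primitive (S := present n)).
    exact: measurable_leq_completed.
  - rewrite -[X in measurable X]setTI; apply: measurable_fun_le => //.
    exact: (info_fun (@measurable_completion_time n m k)).
  - have hs : {ae P, forall w, forall l, (l < m)%N -> 0 <= sojourn Q c n (m - l) w}.
      apply: ae_foralln => l; have [lm|ml] := ltnP l m; last exact: aeW.
      have := @ae_sojourn_ge0 n (m - l); rewrite subn_gt0 => /(_ lm).
      by apply: filterS => w h _.
    by apply: filterS2 hs (ae_interarrival_ge0 n) => w hs hT /=; rewrite leq_completed.
pose C : set (measurableTypeR R * measurableTypeR R) := [set z | z.1 <= z.2].
have mC : measurable C.
  rewrite -[X in measurable X]setTI.
  apply: (@measurable_fun_le _ _ R _ (fun z => z.1) (fun z => z.2)) => //.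
    exact: measurable_fst.
  exact: measurable_snd.
transitivity (P [set w | C (X w, Y w)]) => //.
rewrite (independent_joint_law _ mC); last first.
  apply: (@independent_of_info (completion_sources n m k) [set Interarrival n]).
  - by apply/disj_setPS => z [[l [s [lk ->]]]].
  - exact: measurable_completion_time.
  - exact: (info_measurable_fun (i := Interarrival n)).
transitivity (\int[A]_t (on_nonneg (survival m q k) t)%:E)%E.
  transitivity (\int[A]_t distribution P X (ysection C t))%E.
    by apply: eq_measure_integral => B mB _; exact: (interarrival_law Q n mB).
  apply: eq_integral => t _.
  rewrite -(completion_time_cdf n jm hq kmj km) /distribution /pushforward.
  by congr (P _); apply/seteqP; split => w; rewrite /ysection /C /= inE.
rewrite [RHS]integral_mkcond; apply: eq_integral => t _.
rewrite patchE /on_nonneg; case: ifPn => t0.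
  by rewrite mem_set//= in_itv/= t0.
by rewrite memNset//= in_itv/= (negbTE t0).
Qed.

Definition past n : set source := [set z | match z with
  | Initial => True | Interarrival k => (k < n)%N
  | Service k _ _ => (k < n)%N end].

(** Keeps track of the primitive variables that the chain has used so far: its
    past then is independent of the current inter-arrival interval. *)
Lemma measurable_found n i :
  measurable ([set w | found Q c n w = i] : set (info (past n))).
Proof.
elim: n i => [|n IH] i.
  have := info_preim (Z := primitive) (S := past 0) (i := Initial) I
    (measurable_set1 (i%:R : R)).
  congr measurable; apply/seteqP; split => w /=.
    by move/eqP; rewrite eqr_nat => /eqP.
  by move=> ->.
rewrite (_ : [set w | _] = \bigcup_l ([set w | found Q c n w = l] `&`
    \bigcup_(k in [set k | (l.+1 - k)%N = i])
      [set w | completed Q c n l.+1 w = k])).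
  apply: bigcupT_measurable => l; apply: measurableI.
    apply: info_mono (IH l) => -[|k|k ? ?]//=; exact: ltnW.
  apply: bigcup_measurable => k _.
  apply: info_mono (@measurable_completed n l.+1 k).
  by move=> [|k'|k' ? ?]//= ->.
apply/seteqP; split => w /=.
  by move=> h; exists (found Q c n w) => //; split => //;
    exists (completed Q c n (found Q c n w).+1 w).
by move=> [l _ [<- [k /= <- <-]]].
Qed.

Lemma integrable_survival m j (q : nat -> R -> R) k :
  (j <= m)%N -> forward_equations (service_rate mu c) m j q ->
  (k <= (m - j).+1)%N -> (k <= m)%N ->
  A.-integrable `[0%R, +oo[ (EFin \o survival m q k).
Proof.
move=> jm hq kmj km; apply: (@integrable_bounded _ _ _ 1).
  apply: measurable_funTS; apply: continuous_measurable_fun.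
  exact: (continuous_survival jm hq).
move=> t t0.
have := completion_time_cdf 0 jm hq kmj km t; rewrite /on_nonneg t0 => h.
rewrite ger0_norm -lee_fin -h; last exact: measure_ge0.
apply: probability_le1; rewrite -[X in measurable X]setTI.
by apply: measurable_fun_le => //;
  exact: (info_fun (@measurable_completion_time 0 m k)).
Qed.

(** All m customers may leave but no more: state 0 has no outflow, so the
    probability of m.+1 deaths keeps its initial value 0. *)
Lemma survival_end (m : nat) (q : nat -> R -> R) t :
  forward_equations (service_rate mu c) m 0 q -> survival m q m.+1 t = 0.
Proof.
move=> hq; have h0 := survivalS0 (leq0n m) hq (k := m).
rewrite -h0 ?subn0//; apply: is_derive_0_is_cst => u.
have := is_derive_survival (leq0n m) hq (k := m) u.
by rewrite subn0 leqnn subnn {1}/service_rate min0n !mul0r => /(_ isT).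
Qed.

Lemma prob_completed n m j (q : nat -> R -> R) :
  (j <= m)%N -> forward_equations (service_rate mu c) m j q ->
  fine (P [set w | completed Q c n m w = (m - j)%N]) =
  \int[A]_(t in `[0%R, +oo[) q j t.
Proof.
move=> jm hq; set k := (m - j)%N.
have km : (k <= m)%N by rewrite leq_subr.
have mE l : measurable [set w | (l <= completed Q c n m w)%N].
  apply: (info_measurable measurable_primitive (S := present n)).
  exact: measurable_leq_completed.
have hk : fine (P [set w | (k <= completed Q c n m w)%N]) =
    \int[A]_(t in `[0%R, +oo[) survival m q k t.
  by rewrite (prob_leq_completed n jm hq).
have [hk1 ik1] : fine (P [set w | (k.+1 <= completed Q c n m w)%N]) =
    \int[A]_(t in `[0%R, +oo[) survival m q k.+1 t /\
    A.-integrable `[0%R, +oo[ (EFin \o survival m q k.+1).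
  have [km1|mk] := ltnP k m.
    split; last exact: (integrable_survival jm hq).
    by rewrite (prob_leq_completed n jm hq).
  (* Only j = 0 is left: k.+1 exceeds the number m of customers present, and
     both sides vanish. *)
  have j0 : j = 0%N by rewrite /k in mk; lia.
  have ek : k = m by lia.
  rewrite j0 in hq; rewrite ek.
  rewrite (_ : survival m q m.+1 = cst 0); last first.
    by apply/funext => t; rewrite survival_end.
  rewrite (_ : [set w | _] = set0); last first.
    by apply/seteqP; split => w //=; rewrite ltnNge completed_leq.
  rewrite measure0 Rintegral_cst// mul0r; split => //.
  exact: integrable0.
rewrite (_ : [set w | _] = [set w | (k <= completed Q c n m w)%N] `\`
    [set w | (k.+1 <= completed Q c n m w)%N]); last first.
  apply/seteqP; split => w /=; first by move=> ->; rewrite leqnn ltnn.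
  by move=> [h1 /negP h2]; apply/eqP; rewrite eqn_leq h1 andbT leqNgt.
rewrite measureD//; last by rewrite -ge0_fin_numE// fin_num_measure.
rewrite setIidr; last by move=> w /=; exact: ltnW.
rewrite fineB ?fin_num_measure// hk hk1 -RintegralB//; last first.
  exact: (integrable_survival jm hq).
apply: eq_Rintegral => t _; rewrite survival_diff; congr (q _ _).
by rewrite /k subKn.
Qed.

(** The transition law is the state law of the pure death process observed after
    an independent inter-arrival time: any closed form that solves the forward
    equations may be integrated. *)
Lemma transition_integral n i j (q : nat -> R -> R) :
  (j <= i.+1)%N -> forward_equations (service_rate mu c) i.+1 j q ->
  P [set w | found Q c n w = i] <> 0%E ->
  transition Q c n i j = \int[A]_(t in `[0%R, +oo[) q j t.
Proof.
move=> ji hq hi; rewrite /transition /cond_prob -(prob_completed n ji hq).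
set F := [set w | found Q c n w = i].
set E := [set w | completed Q c n i.+1 w = (i.+1 - j)%N].
have -> : [set w | found Q c n.+1 w = j] `&` F = E `&` F.
  apply/seteqP; split => w [/=] + fi; rewrite fi => h; split => //=.
    by rewrite /E/=; have := completed_leq n i.+1 w; lia.
  by rewrite h subKn.
have mE : measurable E.
  apply: (info_measurable measurable_primitive (S := present n)).
  exact: measurable_completed.
have mF : measurable F.
  apply: (info_measurable measurable_primitive (S := past n)).
  exact: measurable_found.
have -> : P (E `&` F) = (P E * P F)%E.
  apply: (@info_independent _ _ _ _ _ _ measurable_primitive
    primitive_independent (present n) (past n)).
  - by apply/disj_setPS => -[|l|l ? ?] [/= h h'] //; move: h'; rewrite h ltnn.
  - exact: measurable_completed.
  - exact: measurable_found.
rewrite fineM ?fin_num_measure// mulfK//.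
by apply/eqP => F0; apply: hi; rewrite -[LHS]fineK ?fin_num_measure// F0.
Qed.

Lemma transition_gt n i j : (i.+1 < j)%N -> transition Q c n i j = 0.
Proof.
move=> ij; rewrite /transition /cond_prob (_ : _ `&` _ = set0).
  by rewrite measure0 mul0r.
apply/seteqP; split => // w [/= fj fi]; move: ij; rewrite -fj fi.
by rewrite ltnNge leq_subr.
Qed.

End Queue.

Theorem theorem2p3 (R : realType) (d : measure_display)
    (Omega : measurableType d) (P : probability Omega R)
    (A : probability (measurableTypeR R) R) (lambda mu : R) (c : nat)
    (Q : GIMc_queue P A mu)
    (hc : (1 <= c)%N) (hmu : 0 < mu) (hlambda : 0 < lambda)
    (hA : A [set t : R | 0 <= t] = 1%E)
    (hmean : (\int[A]_t t%:E = (lambda^-1)%:E)%E)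
    (n i j : nat) (hi : P [set w | found Q c n w = i] <> 0%E) :
  [/\ ((j <= i.+1)%N && (i.+1 <= c)%N ->
        transition Q c n i j =
        'C(i.+1, i.+1 - j)%:R *
        \sum_(0 <= r < (i.+1 - j).+1)
          (-1) ^+ r * 'C(i.+1 - j, r)%:R * LST A ((j + r)%N%:R * mu)),
      ((c <= j)%N && (j <= i.+1)%N ->
        transition Q c n i j =
        (c%:R * mu) ^+ (i.+1 - j) * LSTn A (i.+1 - j) (c%:R * mu) /
        ((i.+1 - j)`!)%:R),
      ([&& (0 < j)%N, (j.+1 <= c)%N & (c <= i)%N] ->
        transition Q c n i j =
        \sum_(1 <= k < (c - j).+1)
          (-1) ^+ (c - j - k) * (c - k)%N%:R * Ca R c k (c - j) / j%:R *
          (c%:R / k%:R) ^+ (i - c + 2) *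
          (LST A ((c - k)%N%:R * mu) -
           \sum_(0 <= r < (i - c + 1).+1)
             (k%:R * mu) ^+ r * LSTn A r (c%:R * mu) / (r`!)%:R)) &
      ((i.+1 < j)%N -> transition Q c n i j = 0)].
Proof.
have forwardW rate m l q : forward_equations rate m 0 q ->
    @forward_equations R rate m l q.
  by move=> h x /andP[_ xm]; exact: h.
have cmu0 : 0 < c%:R * mu by rewrite mulr_gt0// ltr0n.
split.
- move=> /andP[ji ic].
  have hq := forwardW _ _ j _ (forward_thinning mu ic).
  by rewrite (transition_integral hc hmu hA ji hq hi) integral_thinning_prob.
- move=> /andP[cj ji].
  have hq : forward_equations (service_rate mu c) i.+1 j
      (fun l => poisson_weight (c%:R * mu) (i.+1 - l)).
    by move=> l /andP[jl li]; apply: forward_poisson; rewrite (leq_trans cj jl).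
  by rewrite (transition_integral hc hmu hA ji hq hi) integral_poisson_weight.
- move=> /and3P[j0 jc ci].
  have ji : (j <= i.+1)%N by lia.
  have hq := forwardW _ _ j _ (forward_mixed mu (ci : (c < i.+1)%N)).
  rewrite (transition_integral hc hmu hA ji hq hi).
  by apply: integral_mixed_prob => //; rewrite j0.
- exact: transition_gt.
Qed.
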